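(* Let $p$ be a prime, let $K$ be the completion of the maximal unramified extension of $\mathbb{Q}_p$, and let $X$ be an ultrametric Banach space over $K$ with $|X|=|K|$. Let $A,B$ be $p$-adic Hermite operators on $X$ and let $\psi\in X$ with $|\psi|=1$. Then $$\bigl|[A,B]\psi\bigr|\le \mathrm{diam}(A)\cdot\mathrm{diam}(B).$$
   Context: $K$ carries its multiplicative $p$-adic norm with $|p|=1/p$; the norm on $X$ is non-Archimedean, $|x+y|\le\max(|x|,|y|)$, and $|X|=|K|$ means the two norms have the same set of values. Bounded operators on $X$ carry the operator norm. A bounded linear operator $A$ on $X$ is a $p$-adic Hermite operator if, for some integer $N\ge1$ (its period) and some $k\in\mathbb{Z}$, it can be written as a norm-convergent series $A=\sum_{i=k}^\infty x_ip^i$ where the $x_i$ are pairwise commuting bounded operators on $X$ with $|x_i|\le1$ and $x_i^{p^N}=x_i$. $[A,B]=AB-BA$. $\mathrm{Spec}\,A$ is the spectrum of $A$, i.e. the set of $\lambda\in K$ such that $A-\lambda$ is not invertible as a bounded operator, and $$\mathrm{diam}(A)=\sup_{\lambda,\lambda^*\in\mathrm{Spec}A}|\lambda-\lambda^*|.$$ *)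

(* Defs.v *)
From HB Require Import structures.
From mathcomp Require Import all_boot all_order all_algebra all_field.
From mathcomp Require Import all_classical all_reals all_analysis.

Set Implicit Arguments.
Unset Strict Implicit.
Unset Printing Implicit Defensive.

Import Order.TTheory GRing.Theory Num.Theory.
Import numFieldNormedType.Exports.
Local Open Scope classical_set_scope.
Local Open Scope ring_scope.

(* MathComp-Analysis only has normed modules over ordered (or complex-like)
   scalars, so non-Archimedean absolute values and norms are carried as plain
   functions into a [realType] together with their axioms. *)

Section AbsoluteValues.
Variable R : realType.

Definition ultrametric_abs (F : fieldType) (abs : F -> R) : Prop :=
  [/\ forall x, 0 <= abs x,
      forall x, abs x = 0 <-> x = 0,
      forall x y, abs (x * y) = abs x * abs y &
      forall x y, abs (x + y) <= Num.max (abs x) (abs y)].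

Definition norm_complete (V : zmodType) (nu : V -> R) : Prop :=
  forall u : nat -> V,
    (forall e : R, 0 < e -> exists M : nat, forall m n : nat,
       (M <= m)%N -> (M <= n)%N -> nu (u m - u n) < e) ->
    exists l : V, nu (u n - l) @[n --> \oo] --> (0 : R).

Definition is_completion (F K : fieldType) (absF : F -> R) (absK : K -> R)
    (i : {rmorphism F -> K}) : Prop :=
  [/\ ultrametric_abs absK,
      forall x, absK (i x) = absF x,
      forall (y : K) (e : R), 0 < e -> exists x : F, absK (y - i x) < e &
      norm_complete absK].

Definition padic_abs (p : nat) (x : rat) : R :=
  if x == 0 then 0
  else p%:R ^ ((logn p `|denq x|%N)%:Z - (logn p `|numq x|%N)%:Z).

(* A finite extension is unramified when its ramification index is 1 (same
   value group) and its residue extension is separable.  The latter is spelled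
   out on representatives: every residue class of the valuation ring of E is a
   simple root of the reduction of a polynomial over the valuation ring of F. *)
Definition unramified (F : fieldType) (absF : F -> R)
    (E : fieldExtType F) (absE : E -> R) : Prop :=
  (forall x : E, x != 0 -> exists a : F, absE x = absF a) /\
  (forall x : E, absE x <= 1 -> exists f : {poly F},
     [/\ forall n : nat, absF f`_n <= 1,
         absE (map_poly (in_alg E) f).[x] < 1 &
         absE (map_poly (in_alg E) f^`()).[x] = 1]).

(* The maximal unramified extension of F inside an extension L of F: the union
   of the finite unramified subextensions, each given as a finite extension E
   of F with an F-embedding into L. *)
Definition max_unramified (F L : fieldType) (absF : F -> R) (absL : L -> R)
    (i : {rmorphism F -> L}) : set L :=
  [set y | exists (E : fieldExtType F) (e : {rmorphism E -> L}),
     [/\ forall a : F, e a%:A = i a,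
         unramified absF (fun x : E => absL (e x)) &
         exists x : E, e x = y]].

(* (K, absK) is a completion of the maximal unramified extension Qur of Qp,
   where Qp is a completion of the rationals for the p-adic absolute value and
   Qur is taken inside an algebraic closure Qpbar of Qp, to which the absolute
   value is extended. *)
Definition is_completed_max_unramified (p : nat) (K : fieldType)
    (absK : K -> R) : Prop :=
  exists (Qp : fieldType) (absQp : Qp -> R) (c : {rmorphism rat -> Qp})
         (Qpbar : closedFieldType) (absQpbar : Qpbar -> R)
         (i : {rmorphism Qp -> Qpbar})
         (Qur : fieldType) (j : {rmorphism Qur -> Qpbar})
         (k : {rmorphism Qur -> K}),
    [/\ is_completion (padic_abs p) absQp c,
        forall y : Qpbar, algebraicOver i y,
        ultrametric_abs absQpbar /\ (forall a, absQpbar (i a) = absQp a),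
        range j = max_unramified absQp absQpbar i &
        is_completion (fun x => absQpbar (j x)) absK k].

End AbsoluteValues.

Section Operators.
Variables (R : realType) (K : fieldType) (absK : K -> R).
Variables (X : lmodType K) (normX : X -> R).

Definition ultrametric_banach : Prop :=
  [/\ forall x, 0 <= normX x,
      forall x, normX x = 0 <-> x = 0,
      forall a x, normX (a *: x) = absK a * normX x,
      forall x y, normX (x + y) <= Num.max (normX x) (normX y) &
      norm_complete normX].

Definition bounded_op (T : X -> X) : Prop :=
  exists M : R, forall v, normX (T v) <= M * normX v.

(* Meaningful for bounded operators only: [sup] of an unbounded set is 0. *)
Definition opnorm (T : X -> X) : R :=
  sup [set normX (T v) / normX v | v in [set v | v != 0]].

(* [x n] is the coefficient of p^(k + n). *)
Definition padic_hermite (p : nat) (A : {linear X -> X}) : Prop :=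
  bounded_op A /\
  exists (N : nat) (k : int) (x : nat -> {linear X -> X}),
    [/\ (1 <= N)%N,
        forall n, bounded_op (x n) /\ opnorm (x n) <= 1,
        forall n v, iter (p ^ N) (x n) v = x n v,
        forall m n v, x m (x n v) = x n (x m v) &
        opnorm (fun v => A v - \sum_(n < m) p%:R ^ (k + n%:Z) *: x n v)
          @[m --> \oo] --> (0 : R)].

Definition spectrum (A : {linear X -> X}) : set K :=
  [set lambda | ~ exists S : {linear X -> X},
     [/\ bounded_op S,
         forall v, S (A v - lambda *: v) = v &
         forall v, A (S v) - lambda *: S v = v]].

(* The spectrum of a bounded operator is bounded, so this is a genuine supremum
   as soon as the spectrum is nonempty. *)
Definition spec_diam (A : {linear X -> X}) : R :=
  sup [set absK (lm.1 - lm.2) | lm in spectrum A `*` spectrum A].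

Definition commutator (A B : X -> X) (v : X) : X := A (B v) - B (A v).

End Operators.

(* Main.v *)
(* Choose a in Spec A and b in Spec B.  Then [A,B] = [A-a,B-b], so by the
   ultrametric inequality it is enough that norm (A-a) <= diam A for some a in
   Spec A.  The residue field of K contains F_q, q = p^N, so T^q - T splits
   over K into linear factors whose roots are at mutual distance 1; each
   coefficient x_i of A is annihilated by T^q - T, and commuting coefficients
   have common eigenvectors for arbitrarily many indices i.  Such a choice of
   eigenvalues z_i gives a spectral point sum z_i p^i.  If x_m is the first
   non-scalar coefficient, some two spectral points first differ at the digit
   m, whence diam A >= |p^m|, while A - a involves only the x_i with i >= m.

   The nonzero roots of T^q - T are Teichmuller lifts of the powers of theta, a root of
   an integral lift G of the minimal polynomial over F_p of a generator of
   F_q^*.  The powers of theta below deg G are residually independent over Qp,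
   so G is irreducible and Qp(theta) has the value group of Qp: it is
   unramified. *)
Require Import Defs.
From HB Require Import structures.
From mathcomp Require Import all_boot all_order all_algebra all_field.
From mathcomp Require Import all_classical all_reals all_analysis.
From mathcomp Require Import ring.

Set Implicit Arguments.
Unset Strict Implicit.
Unset Printing Implicit Defensive.

Import Order.TTheory GRing.Theory Num.Theory.
Import numFieldNormedType.Exports.
Local Open Scope classical_set_scope.
Local Open Scope ring_scope.

(** * Ultrametric norms and geometric convergence *)

Definition ultranorm (R : realType) (V : zmodType) (nu : V -> R) : Prop :=
  [/\ forall x, 0 <= nu x,
      forall x, nu x = 0 <-> x = 0,
      forall x, nu (- x) = nu x &
      forall x y, nu (x + y) <= Num.max (nu x) (nu y)].

Section Ultranorm.
Variables (R : realType) (V : zmodType) (nu : V -> R).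
Hypothesis hnu : ultranorm nu.

Lemma un_ge0 x : 0 <= nu x. Proof. by case: hnu. Qed.

Lemma un_eq0 x : (nu x == 0) = (x == 0).
Proof. by case: hnu => _ h _ _; apply/eqP/eqP => /h. Qed.

Lemma un0 : nu 0 = 0.
Proof. by apply/eqP; rewrite un_eq0. Qed.

Lemma un_gt0 x : (0 < nu x) = (x != 0).
Proof. by rewrite lt_neqAle un_ge0 andbT eq_sym un_eq0. Qed.

Lemma unN x : nu (- x) = nu x. Proof. by case: hnu. Qed.

Lemma un_distC x y : nu (x - y) = nu (y - x).
Proof. by rewrite -unN opprB. Qed.

Lemma unD_le C x y : nu x <= C -> nu y <= C -> nu (x + y) <= C.
Proof.
move=> hx hy; case: hnu => _ _ _ /(_ x y) h; apply: (le_trans h).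
by rewrite ge_max hx.
Qed.

Lemma unD_lt C x y : nu x < C -> nu y < C -> nu (x + y) < C.
Proof.
move=> hx hy; case: hnu => _ _ _ /(_ x y) h; apply: (le_lt_trans h).
by rewrite gt_max hx.
Qed.

Lemma unB_le C x y : nu x <= C -> nu y <= C -> nu (x - y) <= C.
Proof. by move=> hx hy; apply: unD_le; rewrite ?unN. Qed.

Lemma unB_lt C x y : nu x < C -> nu y < C -> nu (x - y) < C.
Proof. by move=> hx hy; apply: unD_lt; rewrite ?unN. Qed.

Lemma un_sum_le (I : Type) (r : seq I) (P : pred I) (F : I -> V) C :
  0 <= C -> (forall i, P i -> nu (F i) <= C) -> nu (\sum_(i <- r | P i) F i) <= C.
Proof.
move=> C0 h; elim/big_ind: _ => [|x y|//]; first by rewrite un0.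
exact: unD_le.
Qed.

Lemma un_sum_lt (I : Type) (r : seq I) (P : pred I) (F : I -> V) C :
  0 < C -> (forall i, P i -> nu (F i) < C) -> nu (\sum_(i <- r | P i) F i) < C.
Proof.
move=> C0 h; elim/big_ind: _ => [|x y|//]; first by rewrite un0.
exact: unD_lt.
Qed.

(** If [nu y] were smaller than [nu x], then [x - y] and [y] would both lie in the open ball of
    radius [nu x], and so would their sum [x]. *)
Lemma un_eq x y : nu (x - y) < nu x -> nu y = nu x.
Proof.
move=> h; apply/eqP; rewrite eq_le; apply/andP; split.
  rewrite -[y](subKr x) opprB addrC; apply: unD_le => //.
  by rewrite un_distC ltW.
rewrite leNgt; apply/negP => hyx.
have := unD_lt h hyx; rewrite subrK ltxx //.
Qed.

Lemma un_small0 x : (forall e, 0 < e -> nu x <= e) -> x = 0.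
Proof.
move=> h; apply/eqP; rewrite -un_eq0 eq_le un_ge0 andbT.
by apply/ler_addgt0Pr => e /h; rewrite add0r.
Qed.

(** The difference telescopes, so the ultrametric inequality bounds it by the largest bound on a
    single step. *)
Lemma un_sub_geometric (u : nat -> V) (C k : R) : 0 <= C -> 0 <= k <= 1 ->
  (forall n, nu (u n.+1 - u n) <= C * k ^+ n) ->
  forall n m, (n <= m)%N -> nu (u m - u n) <= C * k ^+ n.
Proof.
move=> C0 /andP[k0 k1] hu n m /subnK <-; elim: (m - n)%N => [|i IHi].
  by rewrite add0n subrr un0 mulr_ge0 ?exprn_ge0.
rewrite -[X in nu X](subrKA (u (i + n)%N)); apply: unD_le => //.
apply: (le_trans (hu _)); rewrite ler_wpM2l // exprD.
by rewrite ler_piMl ?exprn_ge0 // exprn_ile1.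
Qed.

Lemma geometric_small (C k e : R) : 0 <= k < 1 -> 0 < e ->
  exists M, forall n, (M <= n)%N -> C * k ^+ n < e.
Proof.
move=> /andP[k0 k1] e0.
have /cvgrPdist_lt /(_ _ e0) [M _ hM] : (fun n => C * k ^+ n) @ \oo --> (0 : R).
  rewrite -[X in _ --> X](mulr0 C); apply: cvgMr; apply: cvg_expr.
  by rewrite ger0_norm.
exists M => n /hM /=; rewrite sub0r normrN; apply: le_lt_trans; exact: ler_norm.
Qed.

Lemma geometric_limit (u : nat -> V) (C k : R) :
    norm_complete nu -> 0 <= C -> 0 <= k < 1 ->
    (forall n, nu (u n.+1 - u n) <= C * k ^+ n) ->
  exists l, forall n, nu (l - u n) <= C * k ^+ n.
Proof.
move=> hc C0 hk hu; have /andP[k0 k1] := hk.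
have hk' : 0 <= k <= 1 by rewrite k0 ltW.
have hle := un_sub_geometric C0 hk' hu.
case: (hc u) => [e e0|l hl].
  have [M hM] := geometric_small C hk e0; exists M => m n hm hn.
  rewrite -(subrKA (u M)); apply: unD_lt; [|rewrite un_distC];
    by apply: le_lt_trans (hM M _) => //; apply: hle.
exists l => n; apply/ler_addgt0Pr => e e0.
have /cvgrPdist_lt /(_ _ e0) [M _ hM] := hl.
have hC : 0 <= C * k ^+ n by rewrite mulr_ge0 ?exprn_ge0.
rewrite -(subrKA (u (maxn M n))); apply: unD_le.
  rewrite un_distC; have /= := hM _ (leq_maxl M n).
  rewrite sub0r normrN ger0_norm ?un_ge0 // => /ltW /le_trans; apply.
  by rewrite lerDr.
by apply: le_trans (hle _ _ (leq_maxr M n)) _; rewrite lerDl ltW.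
Qed.

End Ultranorm.

(** * Non-Archimedean absolute values on a field *)

Section UltrametricField.
Variables (R : realType) (F : fieldType) (abs : F -> R).
Hypothesis habs : ultrametric_abs abs.

Lemma uaM x y : abs (x * y) = abs x * abs y. Proof. by case: habs. Qed.

Lemma ua1 : abs 1 = 1.
Proof.
case: habs => h0 hz hM _; have : abs 1 * abs 1 = abs 1 * 1 by rewrite -hM !mulr1.
by apply: mulfI; apply/eqP => /hz /eqP; rewrite oner_eq0.
Qed.

Lemma ua_ultranorm : ultranorm abs.
Proof.
case: habs => h0 hz hM hD; split=> // x; rewrite -mulN1r uaM.
suff -> : abs (-1) = 1 by rewrite mul1r.
apply/eqP; rewrite -(@eqrXn2 _ 2) ?ler01 //.
by rewrite expr1n expr2 -uaM mulrNN mulr1 ua1.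
Qed.

Let un := ua_ultranorm.

Lemma uaX x n : abs (x ^+ n) = abs x ^+ n.
Proof.
by elim: n => [|n IHn]; rewrite ?expr0 ?ua1 // !exprS uaM IHn.
Qed.

Lemma uaV x : abs x^-1 = (abs x)^-1.
Proof.
have [->|x0] := eqVneq x 0; first by rewrite invr0 (un0 un) invr0.
have ax0 : abs x != 0 by rewrite (un_eq0 un).
by apply: (mulfI ax0); rewrite -uaM !mulfV // ua1.
Qed.

Lemma uaXz x (z : int) : abs (x ^ z) = abs x ^ z.
Proof.
case: z => n; first by rewrite -!exprnP uaX.
by rewrite !NegzE -!exprnN uaV uaX.
Qed.

Lemma uaM_le1 x y : abs x <= 1 -> abs y <= 1 -> abs (x * y) <= 1.
Proof. by move=> hx hy; rewrite uaM mulr_ile1 ?(un_ge0 un). Qed.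

Lemma uaX_le1 x n : abs x <= 1 -> abs (x ^+ n) <= 1.
Proof. by move=> hx; rewrite uaX exprn_ile1 ?(un_ge0 un). Qed.

Lemma uaM_lt1 x y : abs x < 1 -> abs y <= 1 -> abs (x * y) < 1.
Proof.
move=> hx hy; rewrite uaM; apply: le_lt_trans hx.
by rewrite ler_piMr ?(un_ge0 un).
Qed.

Lemma ua_nat_le1 n : abs n%:R <= 1.
Proof.
elim: n => [|n IHn]; first by rewrite (un0 un).
by rewrite -natr1 (unD_le un) ?ua1.
Qed.

Lemma ua_int_le1 (z : int) : abs z%:~R <= 1.
Proof.
case: z => n; first exact: ua_nat_le1.
by rewrite NegzE mulrNz (unN un) ua_nat_le1.
Qed.

Lemma ua_horner_le (f : {poly F}) x C : 0 <= C -> abs x <= 1 ->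
  (forall i, abs f`_i <= C) -> abs f.[x] <= C.
Proof.
move=> C0 hx hf; rewrite horner_coef; apply: (un_sum_le un) => // i _.
rewrite uaM -[C]mulr1; apply: ler_pM; rewrite ?(un_ge0 un) //.
exact: uaX_le1.
Qed.

Lemma ua_horner_lt1 (f : {poly F}) x : abs x <= 1 ->
  (forall i, abs f`_i < 1) -> abs f.[x] < 1.
Proof.
move=> hx hf; rewrite horner_coef; apply: (un_sum_lt un) => // i _.
exact: uaM_lt1 (hf i) (uaX_le1 _ hx).
Qed.

Lemma ua_int_horner_le1 (h : {poly int}) x : abs x <= 1 ->
  abs (map_poly intr h).[x] <= 1.
Proof.
by move=> hx; apply: ua_horner_le => // i; rewrite coef_map /= ua_int_le1.
Qed.

(** If [abs x] exceeds 1, the leading term strictly dominates all the others, which therefore cannot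
    cancel it. *)
Lemma ua_root_le1 (f : {poly F}) x : f \is monic ->
  (forall i, abs f`_i <= 1) -> root f x -> abs x <= 1.
Proof.
move=> /monicP mf hf /rootP; rewrite leNgt => fx0; apply/negP => hx.
have f0 : f != 0 by rewrite -lead_coef_eq0 mf oner_eq0.
have [n sz] : exists n, size f = n.+1.
  by exists (size f).-1; rewrite prednK // size_poly_gt0.
move: fx0; rewrite horner_coef sz big_ord_recr /=.
have -> : f`_n = 1 by rewrite -mf lead_coefE sz.
rewrite mul1r => /eqP; rewrite addr_eq0 => /eqP /(congr1 abs).
rewrite (unN un) uaX => h; have := ltxx (abs x ^+ n); rewrite -{1}h.
have ltx : forall i, (i < n)%N -> abs x ^+ i < abs x ^+ n.
  by move=> i hi; rewrite ltr_eXn2l.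
rewrite (un_sum_lt un) ?exprn_gt0 ?(lt_trans ltr01) // => i _.
rewrite uaM uaX; apply: le_lt_trans (ltx i (ltn_ord i)).
by rewrite ler_piMl ?exprn_ge0 ?(un_ge0 un).
Qed.

Lemma ua_subX_le x y n : abs x <= 1 -> abs y <= 1 ->
  abs (x ^+ n - y ^+ n) <= abs (x - y).
Proof.
move=> hx hy; rewrite subrXX uaM ler_piMr ?(un_ge0 un) //.
by apply: (un_sum_le un) => // i _; apply: uaM_le1; apply: uaX_le1.
Qed.

(** The cofactor of [x - y] in [x ^+ q - y ^+ q] is [q%:R * y ^+ q.-1] up to an error of norm at
    most [abs (x - y)]. *)
Lemma ua_subX_contract x y q d : abs x <= 1 -> abs y <= 1 ->
  abs (x - y) <= d -> abs q%:R <= d ->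
  abs (x ^+ q - y ^+ q) <= d * abs (x - y).
Proof.
move=> hx hy hd hq; rewrite subrXX uaM mulrC ler_wpM2r ?(un_ge0 un) //.
have d0 : 0 <= d by apply: le_trans hq; rewrite (un_ge0 un).
have -> : \sum_(i < q) x ^+ (q.-1 - i) * y ^+ i =
    \sum_(i < q) (x ^+ (q.-1 - i) - y ^+ (q.-1 - i)) * y ^+ i
    + q%:R * y ^+ q.-1.
  rewrite -[q in q%:R]card_ord -sum1_card natr_sum mulr_suml -big_split /=.
  apply: eq_bigr => i _; rewrite mulrBl mul1r -exprD subnK ?subrK //.
  by case: (q) i => [[]//|n] i; rewrite -ltnS ltn_ord.
apply: (unD_le un); last first.
  by rewrite uaM -[d]mulr1; apply: ler_pM; rewrite ?(un_ge0 un) // uaX_le1.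
apply: (un_sum_le un) => // i _; rewrite uaM -[d]mulr1.
apply: ler_pM; rewrite ?(un_ge0 un) ?uaX_le1 //.
exact: le_trans (ua_subX_le _ hx hy) hd.
Qed.

End UltrametricField.

(** * The residual minimal polynomial of a primitive root *)

Section PrimeInUltrametricField.
Variables (R : realType) (F : fieldType) (abs : F -> R) (p : nat).
Hypotheses (habs : ultrametric_abs abs) (p_prime : prime p).
Hypothesis abs_p : abs p%:R < 1.

Let un := ua_ultranorm habs.

(** By a Bezout relation, an integer prime to [p] of norm below 1 would force 1 itself to have norm
    below 1. *)
Lemma ua_int_lt1 (z : int) : (abs z%:~R < 1) = (p %| z)%Z.
Proof.
apply/idP/idP => [hz|/dvdzP[y ->]]; last first.
  rewrite intrM mulrC; apply: (uaM_lt1 habs) => //.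
  exact: (ua_int_le1 habs).
apply: contraLR hz; rewrite -leNgt => pz.
have /coprimezP[[u v] /= /(congr1 (fun y : int => y%:~R : F)) huv] : coprimez p z.
  by rewrite /coprimez /gcdz /= eqz_nat -/(coprime _ _) prime_coprime.
rewrite leNgt; apply/negP => hz.
have : abs 1%:~R < 1; last by rewrite (ua1 habs) ltxx.
rewrite -huv intrD !intrM; apply: (unD_lt un); rewrite mulrC;
  by apply: (uaM_lt1 habs) => //; apply: (ua_int_le1 habs).
Qed.

Lemma ua_int_horner_dvd (h : {poly int}) x : abs x <= 1 ->
  (forall i, (p %| h`_i)%Z) -> abs (map_poly intr h).[x] < 1.
Proof.
move=> hx hh; apply: (ua_horner_lt1 habs) => // i.
by rewrite coef_map /= ua_int_lt1.
Qed.

End PrimeInUltrametricField.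

(* [G] generates, together with [p], the kernel of the reduction
   Z[X] -> F_q, X |-> a. *)
Lemma primitive_residue_poly (p N : nat) : prime p -> (0 < N)%N ->
  exists (F : finFieldType) (a : F) (G : {poly int}),
    [/\ #|F| = (p ^ N)%N, (p ^ N).-1.-primitive_root a,
        G \is monic /\ root (map_poly intr G) a &
        forall h : {poly int}, (size h < size G)%N ->
          root (map_poly intr h) a -> forall i, (p %| h`_i)%Z].
Proof.
move=> p_prime N0; have [F pF cF] := pPrimePowerField p_prime N0.
have q1 : (1 < p ^ N)%N by rewrite -cF finNzRing_gt1.
have /hasP[a _ ha] : has (p ^ N).-1.-primitive_root [seq x <- enum F | x != 0].
  apply: cyclic.has_prim_root.
  - by rewrite -ltnS prednK // ltnW.
  - apply/allP => x; rewrite mem_filter => /andP[x0 _]; apply/unity_rootP.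
    by apply: (mulfI x0); rewrite mulr1 -exprS prednK ?(ltnW q1) // -cF expf_card.
  - by rewrite filter_uniq ?enum_uniq.
  - rewrite -cF -(cardC1 (0 : F)) cardE.
    apply: uniq_leq_size (enum_uniq _) _ => x.
    by rewrite !mem_enum mem_filter mem_enum !inE andbT.
(* [G] will be a monic integer polynomial of least degree vanishing at [a]; ['X^(p ^ N) - 'X] shows
   that one exists. *)
pose P n := `[< exists G : {poly int},
  [/\ G \is monic, root (map_poly intr G) a & size G = n] >].
have exP : exists n, P n.
  exists (p ^ N).+1; apply/asboolP; exists ('X^(p ^ N) - 'X).
  have sX : (size (- 'X : {poly int}) < size ('X^(p ^ N) : {poly int}))%N.
    by rewrite size_polyN size_polyX size_polyXn.
  split.
  - by rewrite monicE lead_coefDl // lead_coefXn.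
  - rewrite rmorphB /= map_polyXn map_polyX /root !hornerE -cF.
    by rewrite expf_card subrr.
  - by rewrite size_polyDl // size_polyXn.
case: (ex_minnP exP) => n /asboolP[G [mG rG <-]] minG.
exists F, a, G; split => // h.
have [m] := ubnP (size h); elim: m h => // m IHm h.
rewrite ltnS => hm hG hr i.
have [->|h0] := eqVneq h 0; first by rewrite coef0 dvdz0.
have p0F : (p%:R : F) = 0 by rewrite pcharf0.
pose l := lead_coef h; have pl : (p %| l)%Z.
  (* Otherwise [v * p + u * l = 1] makes [h'] monic, of the same size as [h] and still zero at [a],
     against the minimality of [G]. *)
  apply: contraLR (hG); rewrite -leqNgt => pl.
  have /coprimezP[[v u] /= huv] : coprimez p l.
    by rewrite /coprimez /gcdz /= eqz_nat -/(coprime _ _) prime_coprime.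
  pose h' := u *: h + (v * p)%:P * 'X^((size h).-1).
  have sh' : (size h' <= size h)%N.
    rewrite (leq_trans (size_polyD _ _)) // geq_max size_scale_leq /=.
    rewrite mul_polyC (leq_trans (size_scale_leq _ _)) // size_polyXn.
    by rewrite prednK // size_poly_gt0.
  have lh' : h'`_(size h).-1 = 1.
    by rewrite coefD coefZ coefCM coefXn eqxx mulr1 -lead_coefE -huv addrC.
  have sh : size h' = size h.
    apply/eqP; rewrite eqn_leq sh' /= -[size h]prednK ?size_poly_gt0 //.
    by rewrite ltnNge; apply/negP => /leq_sizeP /(_ _ (leqnn _)) /eqP; rewrite lh'.
  rewrite -sh; apply: minG; apply/asboolP; exists h'; split => //.
    by rewrite monicE lead_coefE sh lh'.
  rewrite rmorphD rmorphM /= map_polyC map_polyXn map_polyZ /root !hornerE.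
  by rewrite (rootP hr) mulr0 add0r /= intrM -[(Posz p)%:~R]/(p%:R) p0F mulr0 mul0r.
have [l' hl'] := dvdzP pl.
(* The leading term vanishes at [a] since [p] divides [l], so stripping it lets the induction on the
   size proceed. *)
pose h1 := h - l *: 'X^((size h).-1).
have -> : h`_i = h1`_i + l * (i == (size h).-1)%:R.
  by rewrite coefB coefZ coefXn subrK.
rewrite rpredD ?dvdz_mulr //.
have s1 : (size h1 < size h)%N.
  rewrite -[X in (_ < X)%N]prednK ?size_poly_gt0 // ltnS; apply/leq_sizeP => j hj.
  rewrite coefB coefZ coefXn; case: eqVneq => [->|ne]; first by rewrite mulr1 subrr.
  rewrite mulr0 subr0; apply: nth_default.
  by rewrite -[size h]prednK ?size_poly_gt0 // ltn_neqAle eq_sym ne.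
apply: IHm; first exact: leq_trans s1 hm.
  exact: ltn_trans s1 hG.
rewrite rmorphB /= map_polyZ map_polyXn /root !hornerE (rootP hr) sub0r.
by rewrite /= hl' intrM -[(Posz p)%:~R]/(p%:R) p0F mulr0 mul0r oppr0.
Qed.

(** * An unramified extension with residue field F_q *)

Section Padic.
Variables (R : realType) (p : nat) (p_prime : prime p).
Variables (Qp : fieldType) (absQp : Qp -> R) (c : {rmorphism rat -> Qp}).
Hypothesis hQp : is_completion (padic_abs R p) absQp c.

Let habs : ultrametric_abs absQp. Proof. by case: hQp. Qed.
Let un := ua_ultranorm habs.

Lemma padic_abs_prime : absQp p%:R = p%:R^-1.
Proof.
case: hQp => _ hc _ _; have := hc p%:R; rewrite rmorph_nat => ->.
have p0 : (0 < p)%N by apply: prime_gt0.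
rewrite /padic_abs pnatr_eq0 gtn_eqF //.
have -> : (p%:R : rat) = (p%:Z)%:Q by [].
by rewrite numq_int denq_int /= logn1 -[X in logn p X]expn1 pfactorK.
Qed.

Lemma padic_abs_prime_lt1 : absQp p%:R < 1.
Proof. by rewrite padic_abs_prime invf_lt1 ?ltr0n ?ltr1n ?prime_gt0 ?prime_gt1. Qed.

(** A rational at distance below 1 from [x] has denominator prime to [p]; inverting that denominator
    modulo [p] yields the integer. So the residue field of [Qp] is F_p. *)
Lemma padic_int_approx x : absQp x <= 1 ->
  exists z : int, absQp (x - z%:~R) < 1.
Proof.
move=> hx; have lt1 := ua_int_lt1 habs p_prime padic_abs_prime_lt1.
case: (hQp) => _ _ /(_ x 1 ltr01)[r hr] _.
have hr1 : absQp (c r) <= 1.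
  rewrite -[c r](subKr x) opprB addrC; apply: (unD_le un) => //.
  by rewrite (un_distC un) ltW.
have rE : c r * (denq r)%:~R = (numq r)%:~R.
  by rewrite -!(rmorph_int c) -rmorphM /= -{1}[r]divq_num_den divfK // intr_eq0.
have pd : ~~ (p %| denq r)%Z.
  apply/negP => pd; have pn : (p %| numq r)%Z.
    by rewrite -lt1 -rE mulrC; apply: (uaM_lt1 habs) => //; rewrite lt1.
  have := coprime_num_den r; rewrite /coprime => /eqP g1.
  have : (p %| gcdn `|numq r| `|denq r|)%N by rewrite dvdn_gcd; apply/andP.
  by rewrite g1 dvdn1 => /eqP p1; move: p_prime; rewrite p1.
have /coprimezP[[u v] /= huv] : coprimez p (denq r).
  by rewrite /coprimez /gcdz /= eqz_nat -/(coprime _ _) prime_coprime.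
exists (v * numq r); rewrite -(subrKA (c r)); apply: (unD_lt un) => //.
have -> : c r - (v * numq r)%:~R = (u%:~R * c r) * p%:R.
  rewrite intrM -rE mulrCA mulrA -[X in X - _]mul1r -[X in X * _ - _]/(1%:~R).
  rewrite -huv intrD !intrM -[(Posz p)%:~R]/(p%:R); ring.
rewrite mulrC; apply: (uaM_lt1 habs); first exact: padic_abs_prime_lt1.
by apply: (uaM_le1 habs) => //; apply: (ua_int_le1 habs).
Qed.

Lemma padic_poly_int_approx (g : {poly Qp}) : (forall i, absQp g`_i <= 1) ->
  exists2 h : {poly int}, (size h <= size g)%N &
    forall i, absQp (g`_i - (h`_i)%:~R) < 1.
Proof.
move=> hg; have [z hz] := choice (fun i => padic_int_approx (hg i)).
exists (\poly_(i < size g) z i) => [|i]; first exact: size_poly.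
rewrite coef_poly; case: ltnP => [_ //|hi].
by rewrite nth_default // subr0 (un0 un).
Qed.

Section PrimitiveResidue.
Variables (N : nat) (F : finFieldType) (a : F) (G : {poly int}).
Hypotheses (N0 : (0 < N)%N) (cF : #|F| = (p ^ N)%N).
Hypothesis prim_a : (p ^ N).-1.-primitive_root a.
Hypotheses (mG : G \is monic) (rG : root (map_poly intr G) a).
Hypothesis minG : forall h : {poly int}, (size h < size G)%N ->
  root (map_poly intr h) a -> forall i, (p %| h`_i)%Z.
Variables (L : fieldType) (absL : L -> R) (i : {rmorphism Qp -> L}).
Hypotheses (hL : ultrametric_abs absL) (absLi : forall x, absL (i x) = absQp x).
Variable theta : L.
Hypothesis root_theta : root (map_poly intr G) theta.

Let q := (p ^ N)%N.
Let unL := ua_ultranorm hL.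

Let q_gt1 : (1 < q)%N. Proof. by rewrite /q -cF finNzRing_gt1. Qed.

Let absL_p : absL p%:R < 1.
Proof. by rewrite -(rmorph_nat i) absLi padic_abs_prime_lt1. Qed.

Let theta_le1 : absL theta <= 1.
Proof.
apply: (ua_root_le1 hL (f := map_poly intr G)) => //; first exact: monic_map.
by move=> j; rewrite coef_map /= (ua_int_le1 hL).
Qed.

(** Divide by the monic [G]: the quotient part vanishes at [theta], and the remainder, shorter than
    [G] and zero at [a], has coefficients divisible by [p]. *)
Lemma residue_root_lt1 (h : {poly int}) :
  root (map_poly intr h) a -> absL (map_poly intr h).[theta] < 1.
Proof.
move=> hr; rewrite (Pdiv.RingMonic.rdivp_eq mG h).
set r := Pdiv.Ring.rmodp h G; rewrite rmorphD rmorphM hornerD hornerM.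
rewrite (rootP root_theta) mulr0 add0r.
apply: (ua_int_horner_dvd hL p_prime absL_p theta_le1); apply: minG.
  by rewrite Pdiv.Ring.ltn_rmodp monic_neq0.
move: hr; rewrite {1}(Pdiv.RingMonic.rdivp_eq mG h) rmorphD rmorphM.
by rewrite /root hornerD hornerM (rootP rG) mulr0 add0r.
Qed.

(* [h ^ (q-1) - 1] vanishes at [a]. *)
Lemma residue_nonroot_eq1 (h : {poly int}) :
  ~~ root (map_poly intr h) a -> absL (map_poly intr h).[theta] = 1.
Proof.
move=> hr; set y := (map_poly intr h).[theta].
have : absL (map_poly intr (h ^+ q.-1 - 1)).[theta] < 1.
  apply: residue_root_lt1; rewrite rmorphB rmorphXn rmorph1 /= /root !hornerE.
  rewrite subr_eq0; apply/eqP; apply: (mulfI hr).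
  by rewrite mulr1 -exprS prednK ?(ltnW q_gt1) // /q -cF expf_card.
rewrite rmorphB rmorphXn rmorph1 /= !hornerE -/y (un_distC unL).
rewrite -(ua1 hL) => /(un_eq unL); rewrite (uaX hL) (ua1 hL) => /eqP.
rewrite pexprn_eq1 ?(un_ge0 unL) //.
by rewrite -eqSS prednK ?(ltnW q_gt1) // (gtn_eqF q_gt1) => /eqP.
Qed.

Lemma residue_eval_approx (g : {poly Qp}) : (forall j, absQp g`_j <= 1) ->
  exists h : {poly int}, [/\ (size h <= size g)%N,
    forall j, absQp (g`_j - (h`_j)%:~R) < 1 &
    absL ((map_poly i g).[theta] - (map_poly intr h).[theta]) < 1].
Proof.
move=> /padic_poly_int_approx[h sh hh]; exists h; split => //.
rewrite -hornerN -hornerD; apply: (ua_horner_lt1 hL) => // j.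
by rewrite coefB !coef_map /= -(rmorph_int i) -rmorphB absLi.
Qed.

(** Evaluation at [theta] preserves the Gauss norm. After scaling the largest coefficient to 1, [g]
    is approximated by an integer polynomial with a coefficient prime to [p]; it cannot vanish at
    [a], so its value at [theta] is a unit. *)
Lemma residue_eval_max (g : {poly Qp}) : (size g < size G)%N -> g != 0 ->
  exists2 j, g`_j != 0 & (forall m, absQp g`_m <= absQp g`_j) /\
    absL (map_poly i g).[theta] = absQp g`_j.
Proof.
move=> sg g0.
have [j hj] : exists j, forall m, absQp g`_m <= absQp g`_j.
  have j0 : 'I_(size g) by apply: (Ordinal (n := size g) (m := 0)); rewrite size_poly_gt0.
  case: (@Order.TotalTheory.arg_maxP _ _ _ j0 predT
    (fun j : 'I_(size g) => absQp g`_j)) => // j _ hj.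
  exists j => m; have [hm|hm] := ltnP m (size g); first exact: (hj (Ordinal hm)).
  by rewrite (nth_default _ hm) (un0 un) (un_ge0 un).
have gj : g`_j != 0.
  apply: contra_neq g0 => gj; apply/polyP => m; rewrite coef0; apply/eqP.
  by rewrite -(un_eq0 un) eq_le (un_ge0 un) andbT (le_trans (hj m)) // gj (un0 un).
exists j => //; split => //.
have gj0 : 0 < absQp g`_j by rewrite (un_gt0 un).
pose g' := (g`_j)^-1 *: g.
have g'1 m : absQp g'`_m <= 1.
  by rewrite coefZ (uaM habs) (uaV habs) mulrC ler_pdivrMr // mul1r.
have -> : g = g`_j *: g' by rewrite scalerA mulfV // scale1r.
rewrite map_polyZ hornerZ (uaM hL) /= absLi coefZ (uaM habs).
congr (_ * _).
have g'j : g'`_j = 1 by rewrite coefZ mulVf.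
rewrite g'j (ua1 habs).
have [h [sh hh hth]] := residue_eval_approx g'1.
have sg' : (size h < size G)%N.
  by apply: leq_ltn_trans sh _; rewrite size_scale // invr_eq0.
have hj1 : absQp (h`_j)%:~R = 1.
  by have := hh j; rewrite g'j -(ua1 habs) => /(un_eq un).
have hth1 : absL (map_poly intr h).[theta] = 1.
  apply: residue_nonroot_eq1; apply/negP => /(minG sg') /(_ j).
  by rewrite -(ua_int_lt1 habs p_prime padic_abs_prime_lt1) hj1 ltxx.
by rewrite -hth1; apply: (un_eq unL); rewrite hth1 (un_distC unL).
Qed.

Let GQ : {poly Qp} := map_poly intr G.

Let mGQ : GQ \is monic. Proof. exact: monic_map. Qed.

Let sGQ : size GQ = size G.
Proof. by rewrite size_map_poly_id0 // (monicP mG) oner_eq0. Qed.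

Let rGQ : root (map_poly i GQ) theta.
Proof.
rewrite -map_poly_comp; rewrite (eq_map_poly (g := intr)) // => x /=.
exact: rmorph_int.
Qed.

(** By [residue_eval_max], no nonzero polynomial of smaller degree vanishes at [theta]. *)
Lemma residue_poly_irreducible : irreducible_poly GQ.
Proof.
apply/(subfx_irreducibleP rGQ); first exact: monic_neq0.
move=> g gr g0; rewrite leqNgt sGQ; apply/negP => sg.
have [j gj [_]] := residue_eval_max sg g0.
by rewrite (rootP gr) (un0 unL) => /eqP; rewrite eq_sym (un_eq0 un) (negPf gj).
Qed.

(** The extension is Qp[T]/(G), embedded by sending T to [theta]. Gauss norms are values of [absQp],
    and every residue is a simple root of ['X^q - 'X]. *)
Lemma root_residue_unramified : max_unramified absQp absL i theta.
Proof.
pose E := SubFieldExtType rGQ residue_poly_irreducible.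
pose e : {rmorphism E -> L} := @subfx_inj _ _ i theta GQ.
have nz : GQ != 0 by apply: monic_neq0.
have eE (x : E) : exists2 g : {poly Qp}, (size g < size G)%N &
    e x = (map_poly i g).[theta].
  have [g ->] := subfxE x; exists (g %% GQ); first by rewrite -sGQ ltn_modp.
  rewrite /e /= subfx_inj_eval // {1}(divp_eq g GQ) rmorphD rmorphM hornerD hornerM.
  by rewrite (rootP rGQ) mulr0 add0r.
exists E, e; split; last by exists (subfx_root i theta GQ); apply: subfx_inj_root.
  by move=> x; apply: subfx_inj_base.
split=> [x x0|x hx].
  have [g sg xg] := eE x.
  have g0 : g != 0.
    apply: contra_neq x0 => g0; apply: (fmorph_inj e).
    by rewrite xg g0 !rmorph0 horner0.
  by have [j _ [_ gj]] := residue_eval_max sg g0; exists g`_j; rewrite xg.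
(* One polynomial serves every [x]: its derivative q X^(q-1) - 1 has norm 1 at integral points, as
   [q] has norm below 1. *)
exists ('X^q - 'X); have hq : absL q%:R < 1.
  rewrite /q natrX (uaX hL) exprn_ilt1 ?(un_ge0 unL) //.
  by rewrite -lt0n.
have eX : e x ^+ q - e x = e (map_poly (in_alg E) ('X^q - 'X)).[x].
  by rewrite rmorphB /= map_polyXn map_polyX !hornerE rmorphB rmorphXn.
split.
- move=> n; rewrite coefB coefXn coefX; apply: (unB_le un); exact: (ua_nat_le1 habs).
- rewrite -eX; have [g sg xg] := eE x.
  have g1 j : absQp g`_j <= 1.
    have [->|g0] := eqVneq g 0; first by rewrite coef0 (un0 un) ler01.
    by have [m _ [hm gm]] := residue_eval_max sg g0; rewrite (le_trans (hm j)) // -gm -xg.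
  have [h [_ _ hh]] := residue_eval_approx g1.
  rewrite -xg in hh; set y := (map_poly intr h).[theta] in hh.
  have hy : absL y <= 1 by apply: (ua_int_horner_le1 hL).
  (* Here [y] is an integer polynomial in [theta] close to [e x]; the middle term is small since
     [h ^+ q - h] vanishes at [a], which lies in F_q. *)
  have -> : e x ^+ q - e x = (e x ^+ q - y ^+ q) + (y ^+ q - y) - (e x - y) by ring.
  apply: (unB_lt unL) => //; apply: (unD_lt unL).
    exact: le_lt_trans (ua_subX_le hL _ hx hy) hh.
  have -> : y ^+ q - y = (map_poly intr (h ^+ q - h)).[theta].
    by rewrite rmorphB rmorphXn /= !hornerE.
  apply: residue_root_lt1; rewrite rmorphB rmorphXn /= /root !hornerE.
  by rewrite /q -cF expf_card subrr.
- have -> : (map_poly (in_alg E) ('X^q - 'X)^`()).[x] = x ^+ q.-1 *+ q - 1.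
    rewrite derivB derivXn derivX rmorphB rmorphMn rmorph1 /= map_polyXn.
    by rewrite hornerD hornerN hornerMn hornerXn hornerC.
  rewrite rmorphB rmorphMn rmorphXn rmorph1 (un_distC unL).
  rewrite -(ua1 hL); apply: (un_eq unL); rewrite subKr (ua1 hL).
  rewrite -mulr_natl; apply: (uaM_lt1 hL) => //; exact: (uaX_le1 hL).
Qed.

Lemma root_residue_primitive :
  [/\ absL (theta ^+ q - theta) < 1, absL theta = 1 &
      forall n, (0 < n < q.-1)%N -> absL (theta ^+ n - 1) = 1].
Proof.
have evX n : theta ^+ n = (map_poly intr ('X^n : {poly int})).[theta].
  by rewrite map_polyXn hornerXn.
have evXa n : a ^+ n = (map_poly intr ('X^n : {poly int})).[a].
  by rewrite map_polyXn hornerXn.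
split.
- have -> : theta ^+ q - theta = (map_poly intr ('X^q - 'X : {poly int})).[theta].
    by rewrite rmorphB /= map_polyXn map_polyX !hornerE.
  apply: residue_root_lt1; rewrite rmorphB /= map_polyXn map_polyX /root !hornerE.
  by rewrite /q -cF expf_card subrr.
- have -> : theta = (map_poly intr ('X : {poly int})).[theta].
    by rewrite map_polyX hornerX.
  apply: residue_nonroot_eq1; rewrite map_polyX /root hornerX.
  apply/negP => /eqP a0; have /eqP := prim_expr_order prim_a.
  by rewrite a0 expr0n gtn_eqF ?(prim_order_gt0 prim_a) // eq_sym oner_eq0.
- move=> n /andP[n0 nq].
  have -> : theta ^+ n - 1 = (map_poly intr ('X^n - 1 : {poly int})).[theta].
    by rewrite rmorphB rmorph1 /= map_polyXn !hornerE.
  apply: residue_nonroot_eq1; rewrite rmorphB rmorph1 /= map_polyXn /root !hornerE.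
  by rewrite subr_eq0 -(prim_order_dvd prim_a) gtnNdvd.
Qed.

End PrimitiveResidue.
End Padic.

(** * Teichmuller representatives *)

Section Teichmuller.
Variables (R : realType) (K : fieldType) (abs : K -> R).
Hypotheses (habs : ultrametric_abs abs) (hc : norm_complete abs).

Let un := ua_ultranorm habs.

(** The sequence [x ^+ (q ^ n)] converges to [t], because taking q-th powers shrinks its consecutive
    differences by a factor [d] below 1. *)
Lemma teichmuller_lift (q : nat) (x : K) : abs q%:R < 1 ->
    abs x <= 1 -> abs (x ^+ q - x) < 1 ->
  exists2 t, t ^+ q = t & abs (t - x) < 1.
Proof.
move=> hq hx hxq; pose d := Num.max (abs q%:R) (abs (x ^+ q - x)).
have d1 : d < 1 by rewrite gt_max hq.
have d0 : 0 <= d by rewrite le_max (un_ge0 un).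
pose u n := x ^+ (q ^ n).
have u1 n : abs (u n) <= 1 by apply: (uaX_le1 habs).
have uS n : u n.+1 = u n ^+ q by rewrite /u expnSr exprM.
have hu n : abs (u n.+1 - u n) <= d * d ^+ n.
  elim: n => [|n IHn]; first by rewrite uS /u expn0 expr1 mulr1 le_max lexx orbT.
  rewrite [u n.+2]uS [X in _ - X]uS.
  have hd : abs (u n.+1 - u n) <= d.
    by apply: (le_trans IHn); rewrite ler_piMr // exprn_ile1 // ltW.
  apply: le_trans (ua_subX_contract habs (u1 _) (u1 _) hd _) _.
    by rewrite le_max lexx.
  by rewrite exprS ler_wpM2l.
have dd : 0 <= d < 1 by rewrite d0.
have [t ht] := geometric_limit un hc d0 dd hu.
have t0 : abs (t - x) < 1.
  by apply: le_lt_trans d1; have := ht 0; rewrite /u expn0 !expr1 mulr1.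
have t1 : abs t <= 1.
  by rewrite -(subrK x t); apply: (unD_le un) => //; apply: ltW.
exists t => //; apply/eqP; rewrite -subr_eq0; apply/eqP.
apply: (un_small0 un) => e e0; have [M hM] := geometric_small d dd e0.
rewrite -(subrKA (u M.+1)); apply: (unD_le un).
  rewrite uS; apply: le_trans (ua_subX_le habs _ t1 (u1 M)) _.
  exact: le_trans (ht M) (ltW (hM M (leqnn M))).
by rewrite (un_distC un) (le_trans (ht _)) // ltW // hM.
Qed.

(** The roots are 0 and the powers of the Teichmuller lift [t] of [x]. As [t] is congruent to [x],
    the hypothesis on [x ^+ n - 1] passes to [t] and keeps these powers at distance 1; counting
    degrees shows that no root is missing. *)
Lemma teichmuller_roots (q : nat) (x : K) : (1 < q)%N -> abs q%:R < 1 ->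
    abs x = 1 -> abs (x ^+ q - x) < 1 ->
    (forall n, (0 < n < q.-1)%N -> abs (x ^+ n - 1) = 1) ->
  exists rs : seq K,
    [/\ 'X^q - 'X = \prod_(r <- rs) ('X - r%:P), uniq rs,
        {in rs &, forall r s, r != s -> abs (r - s) = 1} &
        {in rs, forall r, abs r <= 1}].
Proof.
move=> q1 hq hx hxq hxn; have hx1 : abs x <= 1 by rewrite hx.
have [t tq tx] := teichmuller_lift hq hx1 hxq.
have t1 : abs t = 1.
  by rewrite -hx; apply: (un_eq un); rewrite (un_distC un) hx.
have t0 : t != 0 by rewrite -(un_eq0 un) t1 oner_eq0.
have tn n : (0 < n < q.-1)%N -> abs (t ^+ n - 1) = 1.
  move=> hn; rewrite -(hxn n hn); apply: (un_eq un); rewrite hxn //.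
  have -> : x ^+ n - 1 - (t ^+ n - 1) = x ^+ n - t ^+ n by ring.
  apply: le_lt_trans (ua_subX_le habs _ _ _) _; rewrite ?hx ?t1 //.
  by rewrite (un_distC un).
have tij i j : (i < j < q.-1)%N -> abs (t ^+ i - t ^+ j) = 1.
  move=> /andP[ij jq]; rewrite -(subnK (ltnW ij)) exprD -[X in X - _]mul1r.
  rewrite -mulrBl (uaM habs) (uaX habs t) t1 expr1n mulr1 (un_distC un).
  by apply: tn; rewrite subn_gt0 ij (leq_ltn_trans (leq_subr _ _)).
pose s := mkseq (fun i => t ^+ i) q.-1.
have s1 r : r \in s -> abs r = 1.
  by move=> /mapP[i _ ->]; rewrite (uaX habs) t1 expr1n.
have hs : {in s &, forall r r', r != r' -> abs (r - r') = 1}.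
  move=> r r' /mapP[i + ->] /mapP[j + ->]; rewrite !mem_iota !add0n /= => hi hj.
  case: (ltngtP i j) => [ij _|ji _|->]; last by rewrite eqxx.
    by rewrite tij // ij.
  by rewrite (un_distC un) tij // ji.
have us : uniq (0 :: s).
  rewrite /=; apply/andP; split.
    by apply/negP => /s1 /eqP; rewrite (un0 un) eq_sym oner_eq0.
  apply/mkseq_uniqP => i j; rewrite !inE => hi hj /= tE.
  case: (ltngtP i j) => // ij.
    have := tij i j; rewrite tE subrr (un0 un) ij hj => /(_ isT) /eqP.
    by rewrite eq_sym oner_eq0.
  have := tij j i; rewrite tE subrr (un0 un) ij hi => /(_ isT) /eqP.
  by rewrite eq_sym oner_eq0.
exists (0 :: s); split => //; last first.
  by move=> r; rewrite inE => /orP[/eqP->|/s1->//]; rewrite (un0 un).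
- move=> r r'; rewrite !inE => /orP[/eqP->|hr] /orP[/eqP->|hr'] ne.
  - by rewrite eqxx in ne.
  - by rewrite sub0r (unN un) s1.
  - by rewrite subr0 s1.
  - exact: hs.
have sX : (size (- 'X : {poly K}) < size ('X^q : {poly K}))%N.
  by rewrite size_polyN size_polyX size_polyXn.
rewrite -[LHS]scale1r (@all_roots_prod_XsubC _ ('X^q - 'X) (0 :: s)) ?lead_coefDl //.
- by rewrite lead_coefXn !scale1r.
- by rewrite size_polyDl // size_polyXn /= size_mkseq prednK // ltnW.
- apply/andP; split.
    by rewrite /root !hornerE expr0n gtn_eqF ?(ltnW q1) //= subrr.
  apply/allP => r /mapP[i _ ->]; rewrite /root !hornerE.
  by rewrite exprAC tq subrr.
by rewrite uniq_rootsE.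
Qed.

End Teichmuller.

(** * Roots of T^q - T in the completed maximal unramified extension *)

Section CompletedMaxUnramified.
Variables (R : realType) (p : nat) (p_prime : prime p).
Variables (K : fieldType) (absK : K -> R).
Hypothesis hK : is_completed_max_unramified p absK.

Lemma completed_max_unramified_ultrametric : ultrametric_abs absK.
Proof.
by case: hK => ? [? [? [? [? [? [? [? [? [_ _ _ _ []]]]]]]]]].
Qed.

Lemma completed_max_unramified_complete : norm_complete absK.
Proof.
by case: hK => ? [? [? [? [? [? [? [? [? [_ _ _ _ []]]]]]]]]].
Qed.

Lemma completed_max_unramified_prime : absK p%:R = p%:R^-1.
Proof.
case: hK => Qp [absQp [c [L [absL [i [Qur [j [k [hQp _ [hL hi] _ [_ hk _ _]]]]]]]]]].
rewrite -(padic_abs_prime p_prime hQp) -(rmorph_nat k) hk.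
by rewrite -hi !rmorph_nat.
Qed.

(** The root [theta] of [G] generates an unramified extension, so it comes from [Qur]; its image in
    [K] satisfies the same norm relations and can be lifted. *)
Lemma completed_max_unramified_roots (N : nat) : (0 < N)%N ->
  exists rs : seq K,
    [/\ 'X^(p ^ N) - 'X = \prod_(r <- rs) ('X - r%:P), uniq rs,
        {in rs &, forall r s, r != s -> absK (r - s) = 1} &
        {in rs, forall r, absK r <= 1}].
Proof.
move=> N0; have hK0 := completed_max_unramified_ultrametric.
have [F [a [G [cF ha [mG rG] minG]]]] := primitive_residue_poly p_prime N0.
case: (hK) => Qp [absQp [c [L [absL [i [Qur [j [k [hQp _ [hL hi] hj [_ hk _ _]]]]]]]]]].
have [theta rth] : exists theta : L, root (map_poly intr G) theta.
  (* [G] is not constant, since its reduction over [F] has the same size and the root [a]. *)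
  apply/closed_rootP; rewrite size_map_poly_id0 ?(monicP mG) ?oner_eq0 //.
  rewrite -(size_map_poly_id0 (f := intr : int -> F)) ?(monicP mG) ?oner_eq0 //.
  have : (1 < size (map_poly (intr : int -> F) G))%N.
    by apply: root_size_gt1 rG; rewrite monic_neq0 // monic_map.
  by case: size => [|[]].
have : max_unramified absQp absL i theta.
  exact: (root_residue_unramified p_prime hQp N0 cF mG rG minG hL hi rth).
have [tq t1 tn] := root_residue_primitive p_prime hQp cF ha mG rG minG hL hi rth.
rewrite -hj => -[tau _ htau].
apply: (@teichmuller_roots _ _ _ hK0 completed_max_unramified_complete _ (k tau)).
- by rewrite -cF finNzRing_gt1.
- rewrite natrX (uaX hK0) exprn_ilt1 ?(un_ge0 (ua_ultranorm hK0)) -?lt0n //.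
  rewrite completed_max_unramified_prime.
  by rewrite invf_lt1 ?ltr0n ?ltr1n ?prime_gt0 ?prime_gt1.
- by rewrite hk htau.
- by rewrite -rmorphXn -rmorphB hk rmorphB rmorphXn htau.
- by move=> n hn; rewrite -rmorphXn -(rmorph1 k) -rmorphB hk rmorphB rmorphXn rmorph1 htau tn.
Qed.

End CompletedMaxUnramified.

(** * Eigenvectors of commuting operators *)

Section OperatorPolynomials.
Variables (K : fieldType) (X : lmodType K) (x : {linear X -> X}).

Definition op_horner (f : {poly K}) (v : X) : X :=
  \sum_(i < size f) f`_i *: iter i x v.

Lemma op_horner_widen n (f : {poly K}) v : (size f <= n)%N ->
  op_horner f v = \sum_(i < n) f`_i *: iter i x v.
Proof.
move=> hn; rewrite /op_horner (big_ord_widen n (fun i => f`_i *: iter i x v) hn).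
rewrite big_mkcond; apply: eq_bigr => i _; case: ltnP => // hi.
by rewrite nth_default // scale0r.
Qed.

Lemma op_hornerB (f g : {poly K}) v :
  op_horner (f - g) v = op_horner f v - op_horner g v.
Proof.
pose n := maxn (size f) (size g).
rewrite !(@op_horner_widen n) ?leq_maxl ?leq_maxr //; last first.
  by rewrite (leq_trans (size_polyD _ _)) // size_polyN.
by rewrite -sumrB; apply: eq_bigr => i _; rewrite coefB scalerBl.
Qed.

Lemma op_hornerMXsubC (f : {poly K}) r v :
  op_horner (('X - r%:P) * f) v = op_horner f (x v - r *: v).
Proof.
have iterB i : iter i x (x v - r *: v) = iter i.+1 x v - r *: iter i x v.
  by elim: i => [//|i IHi]; rewrite iterS IHi linearB linearZ.
rewrite mulrBl op_hornerB.
rewrite (@op_horner_widen (size f).+1) ?(leq_trans (size_polyMleq _ _)) ?size_polyX //.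
rewrite (@op_horner_widen (size f) (r%:P * f)); last first.
  by rewrite mul_polyC size_scale_leq.
rewrite big_ord_recl coefXM /= scale0r add0r -sumrB; apply: eq_bigr => i _.
by rewrite coefXM coefCM /= iterB scalerBr scalerA [r * _]mulrC iterS.
Qed.

Lemma op_hornerXn n v : op_horner 'X^n v = iter n x v.
Proof.
elim: n v => [|n IHn] v.
  by rewrite /op_horner expr0 size_poly1 big_ord1 coef1 scale1r.
by rewrite exprS -[Y in Y * _]subr0 -polyC0 op_hornerMXsubC IHn scale0r subr0 iterSr.
Qed.

Lemma op_horner_prod (rs : seq K) v :
  op_horner (\prod_(r <- rs) ('X - r%:P)) v = foldl (fun u r => x u - r *: u) v rs.
Proof.
elim: rs v => [|r rs IHrs] v /=; last by rewrite big_cons op_hornerMXsubC IHrs.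
by rewrite big_nil -(expr0 'X) op_hornerXn.
Qed.

(* The last nonzero vector among the partial products (x - r_1)...(x - r_j) v
   is an eigenvector. *)
Lemma annihilated_eigenvector (rs : seq K) v : v != 0 ->
    op_horner (\prod_(r <- rs) ('X - r%:P)) v = 0 ->
  exists r w, [/\ r \in rs, w != 0, x w = r *: w &
    forall (y : {linear X -> X}) s, (forall u, y (x u) = x (y u)) ->
      y v = s *: v -> y w = s *: w].
Proof.
rewrite op_horner_prod; elim: rs v => [|r rs IHrs] v v0 /= h.
  by rewrite h eqxx in v0.
have [u0|u0] := eqVneq (x v - r *: v) 0.
  exists r, v; split => //; first by rewrite mem_head.
  by apply/eqP; rewrite -subr_eq0 u0.
have [s [w [sr w0 xw hw]]] := IHrs _ u0 h.
exists s, w; split => //; first by rewrite inE sr orbT.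
move=> y t yx yv; apply: hw => //.
by rewrite linearB linearZ /= yx yv linearZ /= scalerBr !scalerA [t * r]mulrC.
Qed.

End OperatorPolynomials.

Section CommutingFamily.
Variables (K : fieldType) (X : lmodType K) (x : nat -> {linear X -> X}).
Hypothesis xC : forall m n v, x m (x n v) = x n (x m v).
Variable rs : seq K.
Hypothesis xrs : forall n v, op_horner (x n) (\prod_(r <- rs) ('X - r%:P)) v = 0.

(** Each new vector is an eigenvector of the next operator and keeps all eigenvalue relations of its
    predecessors. The eigenvalues are thus chosen once, whereas the vector may change with [M]. *)
Lemma joint_eigenvalues v : v != 0 ->
  exists z : nat -> K, (forall n, z n \in rs) /\
    forall M, exists w, [/\ w != 0, forall n, (n < M)%N -> x n w = z n *: w &
      forall n s, x n v = s *: v -> x n w = s *: w].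
Proof.
move=> v0.
have step (nv : nat * X) : exists rw : K * X, nv.2 != 0 ->
    [/\ rw.1 \in rs, rw.2 != 0, x nv.1 rw.2 = rw.1 *: rw.2 &
      forall n s, x n nv.2 = s *: nv.2 -> x n rw.2 = s *: rw.2].
  (* A dummy value on the zero vector makes [step] total, as [choice] requires. *)
  have [_|nv0] := eqVneq nv.2 0; first by exists (0, 0).
  have [r [w [rr w0 xw hw]]] := annihilated_eigenvector nv0 (xrs nv.1 nv.2).
  by exists (r, w) => _; split => // n s; apply: hw => u; apply: xC.
have [f hf] := choice step.
pose W := fix W n := if n is n'.+1 then (f (n', W n')).2 else v.
have W0 n : W n != 0 by elim: n => //= n IHn; case: (hf (n, W n) IHn).
have Wstep n := hf (n, W n) (W0 n).
have Wle n m k s : x k (W n) = s *: W n -> x k (W (n + m)%N) = s *: W (n + m)%N.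
  move=> h; elim: m => [|m IHm]; rewrite ?addn0 // addnS.
  by case: (Wstep (n + m)%N) => _ _ _ /(_ _ _ IHm).
exists (fun n => (f (n, W n)).1); split=> [n|M]; first by case: (Wstep n).
exists (W M); split => //; last by move=> n s h; have := @Wle 0 M n s h.
move=> n hn; have := @Wle n.+1 (M - n.+1)%N n; rewrite subnKC //; apply.
by case: (Wstep n).
Qed.

End CommutingFamily.

(** * Spectral points of Hermite series *)

Section BoundedOperators.
Variables (R : realType) (K : fieldType) (absK : K -> R).
Variables (X : lmodType K) (normX : X -> R).
Hypotheses (habs : ultrametric_abs absK) (hX : ultrametric_banach absK normX).

Let unK := ua_ultranorm habs.

Lemma banach_ultranorm : ultranorm normX.
Proof.
case: hX => h0 hz hZ hD _; split=> // v.
by rewrite -scaleN1r hZ (unN unK) (ua1 habs) mul1r.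
Qed.

Let un := banach_ultranorm.

Lemma normZ a v : normX (a *: v) = absK a * normX v.
Proof. by case: hX. Qed.

Lemma opnorm_bound (T : X -> X) v : bounded_op normX T ->
  normX (T v) <= opnorm normX T * normX v.
Proof.
move=> [M hM]; have [->|v0] := eqVneq v 0.
  by have := hM 0; rewrite (un0 un) !mulr0.
rewrite -ler_pdivrMr ?(un_gt0 un) //; apply: ub_le_sup; last by exists v.
exists M => _ [u /= u0 <-]; by rewrite ler_pdivrMr ?(un_gt0 un).
Qed.

Lemma bounded_op_ge0 (T : X -> X) : bounded_op normX T ->
  exists2 M, 0 <= M & forall v, normX (T v) <= M * normX v.
Proof.
move=> [M hM]; exists (Num.max 0 M) => [|v]; first by rewrite le_max lexx.
by apply: le_trans (hM v) _; rewrite ler_wpM2r ?(un_ge0 un) // le_max lexx orbT.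
Qed.

(** A bound [M] for an inverse of [A - a] is contradicted by taking [e = (M + 1)^-1]. *)
Lemma spectrum_approx (A : {linear X -> X}) a :
  (forall e, 0 < e -> exists2 w, w != 0 & normX (A w - a *: w) <= e * normX w) ->
  spectrum normX A a.
Proof.
move=> h [S [/bounded_op_ge0[M M0 hM] SA _]].
have M1 : 0 < M + 1 by rewrite ltr_wpDl.
have [|w w0 hw] := h (M + 1)^-1; first by rewrite invr_gt0.
have := hM (A w - a *: w); rewrite SA => h1.
have : normX w <= M * ((M + 1)^-1 * normX w).
  by apply: le_trans h1 _; rewrite ler_wpM2l.
have nw : 0 < normX w by rewrite (un_gt0 un).
rewrite mulrA ler_pMl // ler_pdivlMr // mul1r.
by rewrite gerDl ler10.
Qed.

(** When [absK a] exceeds a bound of [A], the operator [A - a] multiplies norms by [absK a], so it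
    is injective with bounded inverse; completeness gives surjectivity. *)
Lemma spectrum_bounded (A : {linear X -> X}) : bounded_op normX A ->
  exists M, forall a, spectrum normX A a -> absK a <= M.
Proof.
move=> /bounded_op_ge0[M M0 hM]; exists M => a; apply: contra_notT.
rewrite -ltNge => Ma; have a_gt0 : 0 < absK a by apply: le_lt_trans Ma.
have a0 : a != 0 by rewrite -(un_gt0 unK).
have low v : absK a * normX v <= normX (A v - a *: v).
  have [->|v0] := eqVneq v 0; first by rewrite (un0 un) mulr0 (un_ge0 un).
  rewrite le_eqVlt -normZ; apply/orP; left; rewrite eq_sym; apply/eqP.
  rewrite (un_distC un); apply: (un_eq un); rewrite subKr normZ.
  by apply: le_lt_trans (hM v) _; rewrite ltr_pM2r ?(un_gt0 un).
pose k := M / absK a.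
have k01 : 0 <= k < 1.
  by rewrite /k divr_ge0 ?(ltW a_gt0) // ltr_pdivrMr // mul1r.
have k0 : 0 <= k by case/andP: k01.
have surj v : exists w, A w - a *: w = v.
  (* Solving [A w - a *: w = v] amounts to finding a fixed point of [T], a contraction of ratio [k],
     by iteration from 0. *)
  pose T w := a^-1 *: (A w - v).
  have TB w w' : normX (T w - T w') <= k * normX (w - w').
    rewrite /T -scalerBr [A w' - v]addrC addrKA -linearB normZ (uaV habs).
    by rewrite /k mulrAC mulrC ler_wpM2r ?invr_ge0 ?(ltW a_gt0) //.
  pose u n := iter n T 0.
  have hu n : normX (u n.+1 - u n) <= normX (u 1%N) * k ^+ n.
    elim: n => [|n IHn]; first by rewrite /u /= subr0 mulr1.
    apply: le_trans (TB _ _) _; rewrite exprS mulrCA.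
    by rewrite ler_wpM2l.
  case: hX => _ _ _ _ hc.
  have [l hl] := geometric_limit un hc (un_ge0 un _) k01 hu.
  exists l; apply/eqP; rewrite subr_eq addrC -subr_eq; apply/eqP.
  suff Tl : l = T l by rewrite [in RHS]Tl /T scalerA mulfV // scale1r.
  apply/eqP; rewrite -subr_eq0; apply/eqP; apply: (un_small0 un) => e e0.
  have [m hm] := geometric_small (normX (u 1%N)) k01 e0.
  rewrite -(subrKA (u m.+1)); apply: (unD_le un).
    by apply: le_trans (hl _) _; rewrite ltW // hm.
  apply: le_trans (TB _ _) _; rewrite (un_distC un).
  apply: le_trans (ltW (hm m (leqnn m))); apply: le_trans (hl m).
  by rewrite ler_piMl ?(un_ge0 un) // ltW //; case/andP: k01.
have [S hS] := choice surj.
have inj v w : A v - a *: v = A w - a *: w -> v = w.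
  move=> e; apply/eqP; rewrite -subr_eq0 -(un_eq0 un) eq_le (un_ge0 un) andbT.
  rewrite -(pmulr_rle0 _ a_gt0); apply: le_trans (low _) _.
  rewrite linearB scalerBr opprB [a *: w - _]addrC addrACA e.
  by rewrite [- A w + _]addrC -opprB addNr (un0 un).
have Slin : linear S.
  move=> b v w; apply: inj; rewrite hS linearP scalerDr scalerA mulrC -scalerA.
  by rewrite opprD addrACA -scalerBr !hS.
pose SL : {linear X -> X} := HB.pack S (GRing.isLinear.Build _ _ _ _ S Slin).
exists SL; split => [|v|v]; last exact: hS.
  exists (absK a)^-1 => v; rewrite mulrC ler_pdivlMr // mulrC.
  by apply: le_trans (low _) _; rewrite hS.
by apply: inj; rewrite hS.
Qed.

Lemma spec_diam_ge (A : {linear X -> X}) a b : bounded_op normX A ->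
  spectrum normX A a -> spectrum normX A b ->
  absK (a - b) <= spec_diam absK normX A.
Proof.
move=> /spectrum_bounded[M hM] sa sb; apply: ub_le_sup; last by exists (a, b).
exists M => _ [[l m] /= [hl hm] <-]; apply: (unB_le unK); exact: hM.
Qed.

End BoundedOperators.

(** * Digit expansions of the spectral points of a Hermite series *)

Section HermiteSeries.
Variables (R : realType) (K : fieldType) (absK : K -> R).
Variables (X : lmodType K) (normX : X -> R).
Hypotheses (habs : ultrametric_abs absK) (hX : ultrametric_banach absK normX).
Hypothesis hc : norm_complete absK.
Variables (A : {linear X -> X}) (x : nat -> {linear X -> X}).
Variables (c : nat -> K) (C k : R) (rs : seq K).
Hypotheses (C0 : 0 < C) (k0 : 0 < k) (k1 : k < 1).
Hypothesis absc : forall n, absK (c n) = C * k ^+ n.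
Hypothesis A_bounded : bounded_op normX A.
Hypothesis A_series : forall M v,
  normX (A v - \sum_(n < M) c n *: x n v) <= C * k ^+ M * normX v.
Hypothesis xC : forall m n v, x m (x n v) = x n (x m v).
Hypothesis xrs : forall n v, op_horner (x n) (\prod_(r <- rs) ('X - r%:P)) v = 0.
Hypothesis rs_uniq : uniq rs.
Hypothesis rs_dist : {in rs &, forall r s, r != s -> absK (r - s) = 1}.
Hypothesis rs_le1 : {in rs, forall r, absK r <= 1}.

Let unK := ua_ultranorm habs.
Let un := banach_ultranorm habs hX.

Let k01 : 0 <= k < 1. Proof. by rewrite ltW. Qed.

(** Here [a] is the sum of the [c n * z n], encoded by its tail estimate; the [c n] stand for
    successive powers of [p]. *)
Definition digit_expansion (z : nat -> K) (a : K) : Prop :=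
  (forall n, z n \in rs) /\
  forall M, absK (a - \sum_(n < M) c n * z n) <= C * k ^+ M.

Lemma digit_expansion_exists (z : nat -> K) : (forall n, z n \in rs) ->
  exists a, digit_expansion z a.
Proof.
move=> zrs; pose u M := \sum_(n < M) c n * z n.
have hu M : absK (u M.+1 - u M) <= C * k ^+ M.
  rewrite /u big_ord_recr /= addrAC subrr add0r (uaM habs) absc.
  by rewrite ler_piMr ?mulr_ge0 ?exprn_ge0 ?(ltW C0) ?(ltW k0) ?rs_le1.
by have [a ha] := geometric_limit unK hc (ltW C0) k01 hu; exists a.
Qed.

(** On [v] the two series agree below [M], so only their tails contribute. *)
Lemma digit_expansion_approx z a M v : digit_expansion z a ->
  (forall n, (n < M)%N -> x n v = z n *: v) ->
  normX (A v - a *: v) <= C * k ^+ M * normX v.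
Proof.
move=> [_ ha] hv; rewrite -(subrKA (\sum_(n < M) c n *: x n v)).
apply: (unD_le un) => //; rewrite (un_distC un).
have -> : \sum_(n < M) c n *: x n v = (\sum_(n < M) c n * z n) *: v.
  by rewrite scaler_suml; apply: eq_bigr => n _; rewrite hv ?scalerA.
by rewrite -scalerBl (normZ hX) ler_wpM2r ?(un_ge0 un).
Qed.

(** Joint eigenvectors of the first [M] coefficients are approximate eigenvectors of [A]. The last
    clause lets the choice of [v] prescribe digits. *)
Lemma eigenvector_spectrum v : v != 0 -> exists z a,
  [/\ digit_expansion z a, spectrum normX A a &
      forall n s, x n v = s *: v -> z n = s].
Proof.
move=> v0; have [z [zrs hz]] := joint_eigenvalues xC xrs v0.
have [a za] := digit_expansion_exists zrs; exists z, a; split => //.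
  apply: (spectrum_approx habs hX) => e e0.
  have [M hM] := geometric_small C k01 e0; have [w [w0 hw _]] := hz M.
  exists w => //; apply: le_trans (digit_expansion_approx za hw) _.
  by rewrite ler_wpM2r ?(un_ge0 un) // ltW // hM.
move=> n s hs; have [w [w0 /(_ n (ltnSn n)) h1 /(_ _ _ hs) h2]] := hz n.+1.
apply/eqP; move: h1; rewrite h2 => /eqP.
by rewrite eq_sym -subr_eq0 -scalerBl scaler_eq0 (negPf w0) orbF subr_eq0.
Qed.

(** The terms of index [m] differ by exactly [C * k ^+ m], digits being at distance 1, and the tails
    after them are strictly smaller. *)
Lemma digit_expansion_dist z a z' a' m : digit_expansion z a ->
  digit_expansion z' a' -> (forall n, (n < m)%N -> z n = z' n) ->
  z m != z' m -> absK (a - a') = C * k ^+ m.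
Proof.
move=> [zr ha] [zr' ha'] zz zm; set d := c m * (z m - z' m).
have dE : absK d = C * k ^+ m by rewrite (uaM habs) absc rs_dist // mulr1.
rewrite -dE; apply: (un_eq unK); rewrite dE.
have -> : d - (a - a') = (a' - \sum_(n < m.+1) c n * z' n)
    - (a - \sum_(n < m.+1) c n * z n).
  have zzE : \sum_(n < m) c n * z n = \sum_(n < m) c n * z' n.
    by apply: eq_bigr => n _; rewrite zz.
  by rewrite !big_ord_recr /= zzE /d; ring.
apply: (@le_lt_trans _ _ (C * k ^+ m.+1)); first exact: (unB_le unK).
by rewrite ltr_pM2l // exprS gtr_pMl ?exprn_gt0.
Qed.

(* Let [x m] be the first non-scalar coefficient.  All spectral points share
   the digits before [m], two of them differ at [m], so
   [norm (A - a) <= |p^m| = diam A]. *)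
Lemma hermite_series_center (v : X) : v != 0 -> exists a, forall u,
  normX (A u - a *: u) <= spec_diam absK normX A * normX u.
Proof.
move=> v0; pose P n := `[< forall r, exists u, x n u != r *: u >].
have nP n : ~~ P n -> exists r, forall u, x n u = r *: u.
  move=> /asboolPn /existsNP[r hr]; exists r => u; apply/eqP.
  by apply/negPn/negP => ne; apply: hr; exists u.
have [exP|noP] := pselect (exists n, P n); last first.
  have [z [a [za sa hz]]] := eigenvector_spectrum v0.
  have zs n u : x n u = z n *: u.
    have /nP[r hr] : ~~ P n by apply/negP => Pn; apply: noP; exists n.
    by rewrite (hz n r) // hr.
  (* All coefficients are scalar, so [A] is multiplication by [a] and only the nonnegativity of the
     diameter is left. *)
  exists a => u; have -> : A u - a *: u = 0.
    apply: (un_small0 un) => e e0.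
    have [M hM] := geometric_small (C * normX u) k01 e0.
    apply: le_trans (digit_expansion_approx za (M := M) _) _ => //.
    by rewrite mulrAC ltW // hM.
  rewrite (un0 un) mulr_ge0 ?(un_ge0 un) //.
  by apply: le_trans (spec_diam_ge habs hX A_bounded sa sa); rewrite (un_ge0 unK).
case: (ex_minnP exP) => m /asboolP Pm minm.
have scal n : (n < m)%N -> exists r, forall u, x n u = r *: u.
  by move=> nm; apply: nP; apply/negP => /minm; rewrite leqNgt nm.
have [r [w [rr w0 xw _]]] := annihilated_eigenvector v0 (xrs m v).
(* As [x m] is not the scalar [r], some vector [y'] in the image of [x m - r] is nonzero. It is
   killed by the remaining factors, whose roots differ from [r]; this gives a second eigenvalue
   [s]. *)
have [y ynr] := Pm r; set y' := x m y - r *: y.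
have y'0 : y' != 0 by rewrite subr_eq0.
have hy' : op_horner (x m) (\prod_(s <- rem r rs) ('X - s%:P)) y' = 0.
  by rewrite -op_hornerMXsubC -[RHS](xrs m y) (perm_big _ (perm_to_rem rr)) big_cons.
have [s [w' [sr' w'0 xw' _]]] := annihilated_eigenvector y'0 hy'.
(* Starting from [w] and [w'] forces the digits [r] and [s] at index [m]; the earlier coefficients
   are scalar, so the earlier digits coincide. *)
have [z [a [za sa hz]]] := eigenvector_spectrum w0.
have [z' [a' [za' sa' hz']]] := eigenvector_spectrum w'0.
have zs n u : (n < m)%N -> x n u = z n *: u.
  by move=> /scal[t ht]; rewrite (hz n t) // ht.
have dist : absK (a - a') = C * k ^+ m.
  apply: digit_expansion_dist za za' _ _ => [n nm|].
    by have [t ht] := scal n nm; rewrite (hz n t) ?(hz' n t) // ht.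
  rewrite (hz m r) // (hz' m s) // eq_sym.
  by move: sr'; rewrite mem_rem_uniq // inE => /andP[].
exists a => u; apply: le_trans (digit_expansion_approx za (M := m) _) _.
  by move=> n; apply: zs.
by rewrite ler_wpM2r ?(un_ge0 un) // -dist (spec_diam_ge habs hX).
Qed.

End HermiteSeries.

(** * p-adic Hermite operators and the commutator estimate *)

Section HermiteOperators.
Variables (R : realType) (p : nat) (p_prime : prime p).
Variables (K : fieldType) (absK : K -> R).
Hypothesis hK : is_completed_max_unramified p absK.
Variables (X : lmodType K) (normX : X -> R).
Hypothesis hX : ultrametric_banach absK normX.

Let habs := completed_max_unramified_ultrametric hK.
Let unK := ua_ultranorm habs.
Let un := banach_ultranorm habs hX.

Lemma padic_hermite_center (A : {linear X -> X}) (v : X) : padic_hermite normX p A ->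
  v != 0 -> exists a, forall u,
    normX (A u - a *: u) <= spec_diam absK normX A * normX u.
Proof.
move=> [A_bounded [N [k [x [N0 xb xq xC hlim]]]]].
have [rs [rsE rs_uniq rs_dist rs_le1]] := completed_max_unramified_roots p_prime hK N0.
have absp := completed_max_unramified_prime p_prime hK.
have absp0 : 0 < absK p%:R by rewrite absp invr_gt0 ltr0n prime_gt0.
have absp1 : absK p%:R < 1.
  by rewrite absp invf_lt1 ?ltr0n ?ltr1n ?prime_gt0 ?prime_gt1.
have p0 : (p%:R : K) != 0 by rewrite -(un_gt0 unK).
pose c n : K := p%:R ^ (k + n%:Z); pose C := absK p%:R ^ k.
have C0 : 0 < C by rewrite exprz_gt0.
have absc n : absK (c n) = C * absK p%:R ^+ n.
  by rewrite (uaXz habs) expfzDr ?gt_eqF.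
have x1 n u : normX (x n u) <= normX u.
  have [bx nx] := xb n; apply: le_trans (opnorm_bound habs hX u bx) _.
  by rewrite ler_piMl ?(un_ge0 un).
have cx n u : normX (c n *: x n u) <= C * absK p%:R ^+ n * normX u.
  rewrite (normZ hX) absc ler_wpM2l //.
  by rewrite mulr_ge0 ?exprn_ge0 // ltW.
have pX_le m n : (m <= n)%N -> C * absK p%:R ^+ n <= C * absK p%:R ^+ m.
  move=> mn; rewrite ler_wpM2l ?(ltW C0) //.
  by apply: ler_wiXn2l => //; apply: ltW.
have C_ge0 n u : 0 <= C * absK p%:R ^+ n * normX u.
  by rewrite !mulr_ge0 ?exprn_ge0 ?(un_ge0 un) // ltW.
apply: (@hermite_series_center _ _ _ _ _ habs hX
  (completed_max_unramified_complete hK) A x c C (absK p%:R) rs) => //.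
- move=> M u; have [->|u0] := eqVneq u 0.
    rewrite linear0 big1 ?subrr ?(un0 un) ?mulr0 // => n _.
    by rewrite linear0 scaler0.
  have nu : 0 < normX u by rewrite (un_gt0 un).
  have e0 : 0 < C * absK p%:R ^+ M by rewrite mulr_gt0 ?exprn_gt0.
  have /cvgrPdist_lt /(_ _ e0) [M' _ hM'] := hlim.
  (* The truncation at [m] is already close enough to [A], and the terms with index from [M] up to
     [m] are bounded one by one. *)
  pose m := maxn M M'; have := hM' m (leq_maxr M M') => /=.
  rewrite sub0r normrN => /(le_lt_trans (ler_norm _)) /ltW hm.
  rewrite -(subrKA (\sum_(n < m) c n *: x n u)); apply: (unD_le un).
    apply: le_trans (opnorm_bound habs hX u (T := fun u => A u - \sum_(n < m) c n *: x n u) _) _.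
      (* The remainder must be shown bounded before its [opnorm] controls it, since the [sup] of an
         unbounded set is 0. *)
      have [B B0 hB] := bounded_op_ge0 habs hX A_bounded.
      exists (Num.max B C) => w; apply: (unB_le un).
        by apply: le_trans (hB w) _; rewrite ler_wpM2r ?(un_ge0 un) // le_max lexx.
      apply: (un_sum_le un) => [|n _].
        by rewrite mulr_ge0 ?(un_ge0 un) // le_max B0.
      apply: le_trans (cx n w) _; rewrite ler_wpM2r ?(un_ge0 un) // le_max.
      by rewrite -[X in _ || (_ <= X)]mulr1 -(expr0 (absK p%:R)) pX_le // orbT.
    by rewrite ler_wpM2r ?(un_ge0 un).
  have -> : \sum_(n < m) c n *: x n u - \sum_(n < M) c n *: x n u =
      \sum_(M <= n < m) c n *: x n u.
    rewrite -!(big_mkord predT (fun n => c n *: x n u)).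
    by rewrite (@big_cat_nat _ _ _ M) ?leq_maxl //= addrAC subrr add0r.
  rewrite big_seq; apply: (un_sum_le un) => // n; rewrite mem_index_iota => /andP[Mn _].
  by apply: le_trans (cx n u) _; rewrite ler_wpM2r ?(un_ge0 un) ?pX_le.
- move=> n u; rewrite -rsE op_hornerB op_hornerXn xq -['X]expr1 op_hornerXn.
  exact: subrr.
Qed.

End HermiteOperators.

Theorem theorem1p8 (R : realType) (p : nat) (p_prime : prime p)
    (K : fieldType) (absK : K -> R)
    (hK : is_completed_max_unramified p absK)
    (X : lmodType K) (normX : X -> R)
    (hX : ultrametric_banach absK normX)
    (hXK : range normX = range absK)
    (A B : {linear X -> X})
    (hA : padic_hermite normX p A) (hB : padic_hermite normX p B)
    (psi : X) (hpsi : normX psi = 1) :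
  normX (commutator A B psi) <=
    spec_diam absK normX A * spec_diam absK normX B.
Proof.
have un := banach_ultranorm (completed_max_unramified_ultrametric hK) hX.
have psi0 : psi != 0 by rewrite -(un_eq0 un) hpsi oner_eq0.
have [a ha] := padic_hermite_center p_prime hK hX hA psi0.
have [b hb] := padic_hermite_center p_prime hK hX hB psi0.
have := ha psi; have := hb psi; rewrite hpsi !mulr1 => hb1 ha1.
have dA0 := le_trans (un_ge0 un _) ha1; have dB0 := le_trans (un_ge0 un _) hb1.
(* Scalars are central, so [A,B] = [A-a,B-b]; each of the two products is then bounded by applying
   both center estimates in turn. *)
have -> : commutator A B psi =
    (A (B psi - b *: psi) - a *: (B psi - b *: psi))
    - (B (A psi - a *: psi) - b *: (A psi - a *: psi)).
  rewrite /commutator (linearB A) (linearB B) (linearZ_LR A) (linearZ_LR B).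
  rewrite !scalerBr !scalerA [b * a]mulrC.
  have swap (x y c d e : X) : x - y = (x - c - (d - e)) - (y - d - (c - e)).
    rewrite -[x - c - _]addrA -[y - d - _]addrA -!opprD [c + (d - e)]addrCA.
    by rewrite [in RHS]opprB subrKA.
  exact: swap.
apply: (unB_le un).
  by apply: le_trans (ha _) _; rewrite ler_wpM2l.
by apply: le_trans (hb _) _; rewrite mulrC ler_wpM2r.
Qed.
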